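(* Let $L$ be a BCF lattice with zero. Then $\mathrm{Dim}\,L$ is isomorphic to the commutative monoid $\mathrm{Dim}'L$ defined by generators $\Delta'(p)$, for $p\in\mathrm{J}(L)$, and the following relations, for all $p,q\in\mathrm{J}(L)$: $$\Delta'(p)=\Delta'(q)\quad\text{if }p\mathbin{D^0}q,$$ $$\Delta'(p)\ll\Delta'(q)\quad\text{if either }p\mathbin{D^1}q\text{ or }p\mathbin{D^\infty}q.$$ The isomorphism carries $\Delta(p)$ to $\Delta'(p)$, for all $p\in\mathrm{J}(L)$.
   Context: A partially ordered set $P$ is BCF if every bounded chain of $P$ is finite. The dimension monoid $\mathrm{Dim}\,L$ of a lattice $L$ is the commutative monoid (with zero element $0$) defined by generators $\Delta(x,y)$, for $x\le y$ in $L$, and relations: $\Delta(x,x)=0$; $\Delta(x,z)=\Delta(x,y)+\Delta(y,z)$ for $x\le y\le z$; $\Delta(x\wedge y,x)=\Delta(y,x\vee y)$, for all $x,y,z\in L$. In a commutative monoid, $x\ll y$ means $x+y=y$. $\mathrm{J}(L)$ is the set of join-irreducible elements of $L$, i.e., the nonzero elements $p$ such that $p=x\vee y$ implies $p=x$ or $p=y$. In a BCF lattice with zero every join-irreducible element $p$ is completely join-irreducible, i.e., there is a largest element strictly below $p$, denoted $p_*$. We put $\Delta(p)=\Delta(p_*,p)$. For completely join-irreducible elements $p\neq q$ of $L$: - $p\mathbin{D^0}q$ if there exists $x\in L$ such that $p\nleq x$, $p_*\vee q_*\le x$, and $p\vee x=q\vee x$. - $p\mathbin{D^1}q$ if there exists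 $x\in L$ such that $p\nleq x$, $q_*\le x$, $p\le q\vee x$, and either $p\vee x=p_*\vee x$ or $q\nleq p\vee x$. - $p\mathbin{D^\infty}q$ if there exists $x\in L$ such that $p\nleq x$, $p\vee x=q\vee x$, $p_*\vee q_*\le x$, and $p\nleq q\vee(x\wedge(p\vee q))$. *)

(* Defs.v *)
From HB Require Import structures.
From mathcomp Require Import all_boot all_order all_algebra all_classical.
From mathcomp Require wochoice.

Set Implicit Arguments.
Unset Strict Implicit.
Unset Printing Implicit Defensive.

Import Order.TTheory GRing.Theory.
Local Open Scope quotient_scope.
Local Open Scope classical_set_scope.
Local Open Scope order_scope.

Section Presentation.
Variables (G : choiceType) (R : seq G -> seq G -> Prop).

(* A word [:: g1; ..; gn] stands for the formal sum g1 + .. + gn; the second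
   rule makes words that differ by a permutation congruent.  R s t reads as the
   relation s = t. *)
Inductive pres_cong : seq G -> seq G -> Prop :=
| pres_cong_rel s t : R s t -> pres_cong s t
| pres_cong_comm s t : pres_cong (s ++ t) (t ++ s)
| pres_cong_cat s s' t t' :
    pres_cong s s' -> pres_cong t t' -> pres_cong (s ++ t) (s' ++ t')
| pres_cong_refl s : pres_cong s s
| pres_cong_sym s t : pres_cong s t -> pres_cong t s
| pres_cong_trans s t u : pres_cong s t -> pres_cong t u -> pres_cong s u.

Definition pres_congb : rel (seq G) := fun s t => `[< pres_cong s t >].

Fact pres_congb_equiv : equiv_class_of pres_congb.
Proof.
split=> [s|s t|t s u].
- exact/asboolP/pres_cong_refl.
- by apply/asboolP/asboolP; apply: pres_cong_sym.
- move=> /asboolP st /asboolP tu; apply/asboolP; exact: pres_cong_trans st tu.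
Qed.

Canonical pres_equiv := EquivRelPack pres_congb_equiv.

(* The commutative monoid with generators G and defining relations R. *)
Definition presented := {eq_quot pres_congb}.

HB.instance Definition _ := Choice.on presented.

Definition pres_word (s : seq G) : presented := \pi_presented s.
Definition pres_gen (g : G) : presented := pres_word [:: g].
Definition pres_zero : presented := pres_word [::].
Definition pres_add (x y : presented) : presented :=
  pres_word (repr x ++ repr y).

Lemma pres_wordE s t : pres_word s = pres_word t <-> pres_cong s t.
Proof.
split=> [/eqP|st]; first by rewrite /pres_word (eqmodE pres_equiv) => /asboolP.
by apply/eqP; rewrite /pres_word (eqmodE pres_equiv); apply/asboolP.
Qed.

Lemma pres_wordP x : exists s, x = pres_word s.
Proof. by exists (repr x); rewrite /pres_word reprK. Qed.

Lemma pres_add_cat s t :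
  pres_add (pres_word s) (pres_word t) = pres_word (s ++ t).
Proof.
by apply/pres_wordE; apply: pres_cong_cat; apply/pres_wordE;
  rewrite {1}/pres_word reprK.
Qed.

Fact pres_addA : associative pres_add.
Proof.
move=> x y z; have [[s ->] [t ->] [u ->]] :=
  And3 (pres_wordP x) (pres_wordP y) (pres_wordP z).
by rewrite !pres_add_cat catA.
Qed.

Fact pres_addC : commutative pres_add.
Proof.
move=> x y; have [[s ->] [t ->]] := conj (pres_wordP x) (pres_wordP y).
by rewrite !pres_add_cat; apply/pres_wordE/pres_cong_comm.
Qed.

Fact pres_add0 : left_id pres_zero pres_add.
Proof. by move=> x; have [s ->] := pres_wordP x; rewrite pres_add_cat. Qed.

HB.instance Definition _ :=
  GRing.isNmodule.Build presented pres_addA pres_addC pres_add0.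

End Presentation.

Definition BCF d (P : porderType d) : Prop :=
  forall C : set P, total_on C <=%O -> has_lbound C -> has_ubound C ->
  finite_set C.

Section DimensionMonoid.
Variables (d : Order.disp_t) (L : latticeType d).

Definition dim_itv := {xy : L * L | xy.1 <= xy.2}.
Definition itvl (x y : L) (xy : x <= y) : dim_itv := exist _ (x, y) xy.

Inductive Dim_rel : seq dim_itv -> seq dim_itv -> Prop :=
| Dim_rel0 x : Dim_rel [:: itvl (lexx x)] [::]
| Dim_relD x y z (xy : x <= y) (yz : y <= z) :
    Dim_rel [:: itvl (le_trans xy yz)] [:: itvl xy; itvl yz]
| Dim_relM x y : Dim_rel [:: itvl (leIl x y)] [:: itvl (leUr y x)].

Definition Dim := presented Dim_rel.

Definition Delta (x y : L) (xy : x <= y) : Dim := pres_gen Dim_rel (itvl xy).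

End DimensionMonoid.

Section PrimitiveMonoid.
Variables (d : Order.disp_t) (L : bLatticeType d).
Implicit Types p q : L.

Definition J : set L :=
  [set p | p != \bot /\ forall x y, p = x `|` y -> p = x \/ p = y].

Definition is_lower_star p (m : L) : Prop :=
  m < p /\ forall x, x < p -> x <= m.

Definition completely_join_irreducible p : Prop := exists m, is_lower_star p m.

(* p_*, with the junk value \bot if p is not completely join-irreducible. *)
Definition lower_star p : L := xget \bot (is_lower_star p).

Lemma lower_starP p :
  completely_join_irreducible p -> is_lower_star p (lower_star p).
Proof. exact: xgetPex. Qed.

Lemma lower_star_le p : lower_star p <= p.
Proof.
by rewrite /lower_star; case: xgetP => [m _ [/ltW]|_] //; exact: le0x.
Qed.

Lemma BCF_completely_join_irreducible p :
  BCF L -> J p -> completely_join_irreducible p.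
Proof.
move=> bcfL [p_neq0 irr_p].
have p_gt0 : \bot < p by rewrite lt0x.
have ltU x y : x < p -> y < p -> x `|` y < p.
  move=> xp yp; rewrite lt_neqAle leUx (ltW xp) (ltW yp) !andbT.
  apply/eqP => /esym /irr_p.
  by case=> e; [move: xp | move: yp]; rewrite -e ltxx.
have [||C sC chainC|m mp maxm] :=
    @wochoice.Zorn's_lemma L <=%O [pred x | x < p] _ _ _.
- by move=> x _.
- by move=> x y z _ _ _; apply: le_trans.
- have /finite_seqP[s sE] : finite_set [set x | x \in C].
    apply: bcfL.
      by move=> x y Cx Cy; apply/orP/(wochoice.wo_chainW chainC).
      by exists \bot => x _; exact: le0x.
    by exists p => x /sC /ltW.
  have inC x : x \in C = (x \in s).
    by apply/idP/idP => [Cx|sx]; [move: sE => /seteqP[/(_ x Cx)]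
                                 |move: sE => /seteqP[_ /(_ x sx)]].
  exists (\join_(x <- s) x)%O.
    rewrite inE big_seq; elim/big_ind: _ => // x; rewrite -inC; exact: sC.
  by move=> x; rewrite inC => sx; apply: joins_sup_seq.
- exists m; split=> // x xp; have /maxm : x `|` m \in [pred x | x < p].
    by rewrite inE ltU.
  by rewrite leUr leUx => /(_ isT)/andP[].
Qed.

Definition Delta_at p : Dim L := Delta (lower_star_le p).

Definition D0 p q : Prop :=
  p != q /\ exists x,
    [/\ ~~ (p <= x), lower_star p `|` lower_star q <= x & p `|` x = q `|` x].

Definition D1 p q : Prop :=
  p != q /\ exists x,
    [/\ ~~ (p <= x), lower_star q <= x, p <= q `|` x &
        p `|` x = lower_star p `|` x \/ ~~ (q <= p `|` x)].

Definition Dinf p q : Prop :=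
  p != q /\ exists x,
    [/\ ~~ (p <= x), p `|` x = q `|` x, lower_star p `|` lower_star q <= x &
        ~~ (p <= q `|` (x `&` (p `|` q)))].

(* p << q is p + q = q in the commutative monoid. *)
Inductive Dim'_rel : seq J -> seq J -> Prop :=
| Dim'_rel_eq (p q : J) : D0 (val p) (val q) -> Dim'_rel [:: p] [:: q]
| Dim'_rel_ll (p q : J) :
    D1 (val p) (val q) \/ Dinf (val p) (val q) -> Dim'_rel [:: p; q] [:: q].

Definition Dim' := presented Dim'_rel.

Definition Delta' (p : J) : Dim' := pres_gen Dim'_rel p.

End PrimitiveMonoid.

Arguments J {d} L _.

(* Main.v *)
(* In a BCF lattice a minimal element below t but not below u is
   join-irreducible, so every interval [x, y] is traversed by finitely many
   steps u -> u `|` p with p join-irreducible, p not below u and p_* <= u; such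
   a step is a perspective of [p_*, p], hence has dimension Delta p.  Adding up
   Delta' p along the steps gives a map to Dim' L.  A sequence of steps from u
   to u `|` p always adds up to Delta' p: one of its steps equals Delta' p by
   D^0, and the others are absorbed by D^1.  This gives both the independence of
   the steps chosen (by induction downwards from y) and the invariance under
   perspectivity, except for the part of [x `&` y, x] collapsed by the first
   step p, which D^1 and D^oo show to be absorbed by Delta' p.  Conversely the
   relations of Dim' L hold in Dim L by cutting intervals above x and
   transposing [p_*, p] and [q_*, q] into them. *)

From HB Require Import structures.
Require Import Defs.
From mathcomp Require Import all_boot all_order all_algebra all_classical.
From mathcomp Require wochoice.

Set Implicit Arguments.
Unset Strict Implicit.
Unset Printing Implicit Defensive.

Import Order.TTheory GRing.Theory.
Local Open Scope classical_set_scope.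
Local Open Scope order_scope.

(** * Universal property of presented commutative monoids *)

Section PresentedMonoid.
Variables (G : choiceType) (R : seq G -> seq G -> Prop).

Lemma pres_rel s t : R s t -> pres_word R s = pres_word R t.
Proof. by move=> st; apply/pres_wordE/pres_cong_rel. Qed.

Lemma pres_word_sum s : pres_word R s = (\sum_(g <- s) pres_gen R g)%R.
Proof.
elim: s => [|g s IHs]; first by rewrite big_nil.
by rewrite big_cons -IHs -cat1s -pres_add_cat.
Qed.

(** Summing [h] over a word respects every rule generating [pres_cong], so the sum over the
    representative [repr x] does not depend on which word represents [x]. *)
Lemma pres_lift (M : nmodType) (h : G -> M) :
    (forall s t, R s t -> \sum_(g <- s) h g = \sum_(g <- t) h g)%R ->
  exists f : {additive presented R -> M}, forall g, f (pres_gen R g) = h g.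
Proof.
move=> hR.
pose f (x : presented R) := (\sum_(g <- repr x) h g)%R.
have f_word s : f (pres_word R s) = (\sum_(g <- s) h g)%R.
  rewrite /f.
  have : pres_cong R (repr (pres_word R s)) s.
    by apply/pres_wordE; rewrite {1}/pres_word reprK.
  move: (repr _) => t; elim: t s / => //.
  - by move=> s t; rewrite !big_cat /= addrC.
  - by move=> s s' t t' _ ss' _ tt'; rewrite !big_cat /= ss' tt'.
  - by move=> s t u _ -> _ ->.
have f_add : nmod_morphism f.
  split=> [|x y]; first by rewrite [LHS](f_word [::]) big_nil.
  have [[s ->] [t ->]] := conj (pres_wordP x) (pres_wordP y).
  by rewrite [in LHS]/GRing.add /= pres_add_cat !f_word big_cat.
exists (HB.pack_for {additive presented R -> M} f
          (GRing.isNmodMorphism.Build _ _ f f_add)) => g /=.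
by rewrite f_word big_seq1.
Qed.

Lemma pres_gen_cancel (M : nmodType)
    (f : {additive presented R -> M}) (g : {additive M -> presented R}) :
  (forall a, g (f (pres_gen R a)) = pres_gen R a) -> cancel f g.
Proof.
move=> fK x; have [s ->] := pres_wordP x.
by rewrite pres_word_sum !raddf_sum; apply: eq_bigr => a _.
Qed.

End PresentedMonoid.

(** * Extremal elements and induction in BCF posets *)

(** Zorn's lemma applies: a chain in [A] inherits the bounds of [A], so it is finite and, if
    nonempty, has a greatest element in [A]. The empty chain is bounded by the given [a]. *)
Lemma BCF_maximal d (P : porderType d) (A : set P) : BCF P ->
    A !=set0 -> has_lbound A -> has_ubound A ->
  exists2 m, A m & forall x, A x -> m <= x -> x = m.
Proof.
move=> bcfP [a Aa] [l Al] [u Au].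
have [|||m] := @wochoice.Zorn's_lemma P <=%O (fun x => `[< A x >]) _ _ _.
- by move=> x _; apply: lexx.
- by move=> x y z _ _ _; apply: le_trans.
- move=> C sCA /wochoice.wo_chainW chainC.
  have {}sCA x : x \in C -> A x by move=> /sCA/asboolP.
  have /finite_seqP[s sE] : finite_set [set x | x \in C].
    apply: bcfP; first by move=> x y Cx Cy; apply/orP/chainC.
    - by exists l => x /sCA /Al.
    - by exists u => x /sCA /Au.
  have inC x : x \in C = (x \in s).
    by apply/idP/idP => [Cx|sx]; [move: sE => /seteqP[/(_ x Cx)]
                                 |move: sE => /seteqP[_ /(_ x sx)]].
  have ub (t : seq P) x : {subset x :: t <= C} ->
      exists2 z, z \in C & forall y, y \in x :: t -> y <= z.
    elim: t x => [|y t IHt] x sC.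
      by exists x => [|y]; rewrite ?sC ?mem_head// inE => /eqP->.
    have Cx : x \in C by apply/sC/mem_head.
    have /IHt[z Cz tz] : {subset y :: t <= C}.
      by move=> w tw; apply: sC; rewrite inE tw orbT.
    have /orP[xz|zx] := chainC _ _ Cx Cz.
      by exists z => // w; rewrite inE => /predU1P[->//|/tz].
    exists x => // w; rewrite inE => /predU1P[->//|/tz wz].
    exact: le_trans wz zx.
  case: s inC {sE} => [|x s] inC.
    by exists a => [|y]; [exact/asboolP | rewrite inC].
  have [|z Cz sz] := ub s x; first by move=> y; rewrite inC.
  by exists z => [|y]; [apply/asboolP/sCA | rewrite inC => /sz].
move=> /asboolP Am maxm; exists m => // x Ax mx; apply: le_anti.
by rewrite mx andbT maxm//; apply/asboolP.
Qed.

Lemma BCF_minimal d (P : porderType d) (A : set P) : BCF P ->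
    A !=set0 -> has_lbound A -> has_ubound A ->
  exists2 m, A m & forall x, A x -> x <= m -> x = m.
Proof.
move=> bcfP A0 lA uA; apply: (@BCF_maximal _ P^d A) => //.
move=> C chainC [l lC] [u uC]; apply: (bcfP C); last 2 first.
- by exists u => x /uC.
- by exists l => x /lC.
by move=> x y Cx Cy; apply: chainC.
Qed.

(** A maximal counterexample between [x] and [y] would contradict the induction step. *)
Lemma BCF_up_ind d (P : porderType d) (y : P) (Q : P -> Prop) : BCF P ->
    (forall x, x <= y -> (forall z, x < z -> z <= y -> Q z) -> Q x) ->
  forall x, x <= y -> Q x.
Proof.
move=> bcfP step x xy; apply: contrapT => nQx.
have [||| m [xm my nQm] max_m] :=
  @BCF_maximal _ P [set z | [/\ x <= z, z <= y & ~ Q z]] bcfP.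
- by exists x; split.
- by exists x => z [].
- by exists y => z [].
apply/nQm/step => // z mz zy; apply: contrapT => nQz.
have zm : z = m by apply: max_m (ltW mz); split=> //; apply: le_trans (ltW mz).
by rewrite zm ltxx in mz.
Qed.

(** * Join-irreducible elements and the relations of [Dim' L] *)

Section BCFLattice.
Variables (d : Order.disp_t) (L : bLatticeType d).
Hypothesis bcfL : BCF L.
Implicit Types (x y z u v w : L) (p q r : J L).

Local Notation "p ^_*" := (lower_star (val p)) (at level 2, format "p ^_*").

Lemma lower_star_lt p : p^_* < val p.
Proof.
by have /(BCF_completely_join_irreducible bcfL)/lower_starP[] := set_valP p.
Qed.

Lemma lt_lower_star p x : x < val p -> x <= p^_*.
Proof.
have /(BCF_completely_join_irreducible bcfL)/lower_starP[_] := set_valP p.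
exact.
Qed.

Lemma meet_lower_star p x : ~~ (val p <= x) -> p^_* <= x -> val p `&` x = p^_*.
Proof.
move=> npx px; apply/le_anti; rewrite lexI px lower_star_le !andbT.
by apply: lt_lower_star; rewrite lt_neqAle leIl andbT eq_meetl.
Qed.

(** By minimality everything strictly below the chosen [p] lies below [u]. Hence so does the join of
    two such elements, which therefore differs from [p]; the same argument bounds [p^_*]. *)
Lemma J_witness t u : ~~ (t <= u) ->
  exists p, [/\ val p <= t, ~~ (val p <= u) & p^_* <= u].
Proof.
move=> ntu.
have [||| p [pt npu] min_p] :=
  @BCF_minimal _ L [set s : L | s <= t /\ ~~ (s <= u)] bcfL.
- by exists t.
- by exists \bot => s _; apply: le0x.
- by exists t => s [].
have lt_p s : s < p -> s <= u.
  move=> sp; apply: contraT => nsu.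
  by have := min_p s (conj (le_trans (ltW sp) pt) nsu) (ltW sp) => sE;
    rewrite sE ltxx in sp.
have Jp : J L p.
  split=> [|x y pE]; first by apply: contraNneq npu => ->; apply: le0x.
  have [-> | xp] := eqVneq x p; first by left.
  have [-> | yp] := eqVneq y p; first by right.
  case/negP: npu; rewrite pE leUx !lt_p // lt_neqAle ?xp ?yp pE ?leUl ?leUr //.
exists (SigSub (mem_set Jp)); split=> //.
exact/lt_p/lower_star_lt.
Qed.

Local Open Scope ring_scope.

(** Adds to the defining relation the case [p = q], which [D0] excludes. *)
Lemma D0_eq p q x : ~~ (val p <= x)%O -> (p^_* <= x)%O -> (q^_* <= x)%O ->
  (val p `|` x = val q `|` x)%O -> Delta' p = Delta' q.
Proof.
move=> npx px qx pqx; have [/val_inj -> // | pq] := eqVneq (val p) (val q).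
apply/pres_rel/Dim'_rel_eq; split=> //; exists x; split=> //.
by rewrite leUx px.
Qed.

Lemma ll_Delta' p q : D1 (val p) (val q) \/ Dinf (val p) (val q) ->
  Delta' p + Delta' q = Delta' q.
Proof.
by move=> pq; rewrite [LHS]pres_add_cat; apply/pres_rel/Dim'_rel_ll.
Qed.

(** * Sums of [Delta'] along chains, a relation because each step is a free choice *)

Inductive chain_sum y : L -> Dim' L -> Prop :=
| chain_sum0 : chain_sum y y 0
| chain_sumS x p m : ~~ (val p <= x)%O -> (p^_* <= x)%O ->
    chain_sum y (x `|` val p)%O m -> chain_sum y x (Delta' p + m).

Lemma chain_sum_le x y m : chain_sum y x m -> (x <= y)%O.
Proof. by elim=> // {}x p {}m _ _ _; apply/le_trans/leUl. Qed.

Lemma chain_sumxx x m : chain_sum x x m -> m = 0.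
Proof.
suff eq0 y z n : chain_sum y z n -> z = y -> n = 0 by move/eq0 => ->.
case=> // {}z p {}n npz _ /chain_sum_le zpy zy.
by move: zpy; rewrite -zy leUx (negbTE npz) andbF.
Qed.

Lemma chain_sum_ex x y : (x <= y)%O -> exists m, chain_sum y x m.
Proof.
move: x; apply: (BCF_up_ind bcfL) => x.
rewrite le_eqVlt => /predU1P[-> _|]; first by exists 0; constructor.
move=> xy IH; have [p [py npx px]] := J_witness (negbT (lt_geF xy)).
have [||m ch] := IH (x `|` val p)%O.
- by rewrite lt_neqAle leUl eq_sym eq_joinl npx.
- by rewrite leUx (ltW xy).
- by exists (Delta' p + m); constructor.
Qed.

Lemma chain_sum_cat x y z m n :
  chain_sum y x m -> chain_sum z y n -> chain_sum z x (m + n).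
Proof.
elim=> [|{}x p {}m npx px _ IH] ?; rewrite ?add0r// -addrA.
by constructor; auto.
Qed.

(** Let [q] be the first step. If it already reaches [p], it reaches the top, and [D0] identifies
    [q] with [p]. Otherwise the remaining steps sum to [Delta' p] by induction, and [q] is absorbed
    because [D1 q p] holds with witness [x]. *)
Lemma chain_sum_perspective p x m : ~~ (val p <= x)%O -> (p^_* <= x)%O ->
  chain_sum (x `|` val p)%O x m -> m = Delta' p.
Proof.
move=> npx px; move yE: (x `|` val p)%O => y ch.
elim: ch yE npx px => [|{}x q {}m nqx qx ch IH] yE npx px.
  by move: npx; rewrite -yE leUr.
have zy := chain_sum_le ch.
have [pz | npz] := boolP (val p <= x `|` val q)%O.
  have zE : (x `|` val q = y)%O.
    by apply: le_anti; rewrite zy -yE leUx leUl.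
  rewrite zE in ch; rewrite (chain_sumxx ch) addr0.
  by apply: (@D0_eq _ _ x) => //; rewrite ![(_ `|` x)%O]joinC zE.
rewrite (IH _ npz) ?(le_trans px) ?leUl//; last first.
  by rewrite joinAC yE join_l// (le_trans (leUr _ _) zy).
apply: ll_Delta'; left; split.
  by apply: contraNneq npz => <-; apply: leUr.
exists x; split=> //; last by right; rewrite joinC.
by rewrite joinC yE (le_trans (leUr _ _) zy).
Qed.

Lemma chain_sum_inv x y m : chain_sum y x m -> (x < y)%O ->
  exists p n, [/\ ~~ (val p <= x)%O, (p^_* <= x)%O,
    chain_sum y (x `|` val p)%O n & m = Delta' p + n].
Proof.
by case=> [|{}x p {}m npx px ch] xy; [rewrite ltxx in xy | exists p, m].
Qed.

(** A confluence argument: two different first steps are joined further up, and uniqueness above [x]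
    is the induction hypothesis. *)
Lemma chain_sum_uniq x y m n : chain_sum y x m -> chain_sum y x n -> m = n.
Proof.
move=> chm chn; have xy := chain_sum_le chm.
move: x xy m n chm chn; apply: (BCF_up_ind bcfL) => x.
rewrite le_eqVlt => /predU1P[-> _ m n /chain_sumxx-> /chain_sumxx-> //|xy IH].
have lt_step p : ~~ (val p <= x)%O -> (x < x `|` val p)%O.
  by move=> npx; rewrite lt_neqAle leUl eq_sym eq_joinl npx.
(* If the step [p] passes over [q], the chain through [q] can be rerouted through the top of the
   step [p]; its part up to there sums to [Delta' p]. *)
have absorbed p q m n : ~~ (val p <= x)%O -> (p^_* <= x)%O ->
    ~~ (val q <= x)%O -> (q^_* <= x)%O -> (val q <= x `|` val p)%O ->
    chain_sum y (x `|` val p)%O m -> chain_sum y (x `|` val q)%O n ->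
  Delta' p + m = Delta' q + n.
  move=> npx px nqx qx qxp chm chn.
  have [|t cht] := @chain_sum_ex (x `|` val q) (x `|` val p).
    by rewrite leUx leUl.
  have -> : n = t + m.
    apply: (IH _ (lt_step _ nqx) (chain_sum_le chn) _ _ chn).
    exact: chain_sum_cat chm.
  rewrite addrA; congr (_ + m); apply/esym.
  by apply: chain_sum_perspective npx px _; constructor.
move=> m n /chain_sum_inv/(_ xy)[p [m' [npx px chm ->]]].
move=> /chain_sum_inv/(_ xy)[q [n' [nqx qx chn ->]]] {m n}.
have [qp | nqp] := boolP (val q <= x `|` val p)%O; first exact: absorbed.
have [pq | npq] := boolP (val p <= x `|` val q)%O; first exact/esym/absorbed.
have xpy := chain_sum_le chm; have xqy := chain_sum_le chn.
(* Neither step passes over the other: both chains are rerouted through the join of [x], [p] and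
   [q], where opposite sides of the square have equal sums. *)
have [|l chl] := @chain_sum_ex (x `|` val p `|` val q) y.
  by rewrite leUx xpy (le_trans _ xqy) ?leUr.
have [s chs] := @chain_sum_ex (x `|` val p) (x `|` val p `|` val q) (leUl _ _).
have [|t cht] := @chain_sum_ex (x `|` val q) (x `|` val p `|` val q).
  by rewrite leUx leUr andbT (le_trans (leUl _ _) (leUl _ _)).
have -> : m' = s + l.
  by apply: (IH _ (lt_step _ npx) xpy _ _ chm); apply: chain_sum_cat chl.
have -> : n' = t + l.
  by apply: (IH _ (lt_step _ nqx) xqy _ _ chn); apply: chain_sum_cat chl.
rewrite joinAC in cht.
rewrite (chain_sum_perspective nqp _ chs) ?(le_trans qx) ?leUl//.
rewrite (chain_sum_perspective npq _ cht) ?(le_trans px) ?leUl//.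
by rewrite !addrA (addrC (Delta' p)).
Qed.

(** * The dimension of intervals with values in [Dim' L], and its invariance under perspectivity *)

Definition chain_dim x y : Dim' L := xget 0 (chain_sum y x).

Lemma chain_dimE x y m : chain_sum y x m -> chain_dim x y = m.
Proof.
move=> ch; rewrite /chain_dim; case: xgetP => [n _ chn|/(_ m)//].
exact: chain_sum_uniq chn ch.
Qed.

Lemma chain_dimP x y : (x <= y)%O -> chain_sum y x (chain_dim x y).
Proof. by move=> /chain_sum_ex[m ch]; rewrite (chain_dimE ch). Qed.

Lemma chain_dimxx x : chain_dim x x = 0.
Proof. by apply: chain_dimE; constructor. Qed.

Lemma chain_dimD x y z : (x <= y)%O -> (y <= z)%O ->
  chain_dim x z = chain_dim x y + chain_dim y z.
Proof.
move=> /chain_dimP xy /chain_dimP yz; apply: chain_dimE.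
exact: chain_sum_cat xy yz.
Qed.

Lemma chain_dim_perspective p x : ~~ (val p <= x)%O -> (p^_* <= x)%O ->
  chain_dim x (x `|` val p)%O = Delta' p.
Proof.
by move=> npx px; apply: chain_sum_perspective npx px (chain_dimP (leUl _ _)).
Qed.

(* [q] is chosen so that [p] is not below [q `|` y] whenever this is possible;
   otherwise every [w <= v] with [p] not below [w `|` y] lies below [u], which
   is what [Dinf] requires of [w = (q_* `|` y) `&` (p `|` q)]. *)
Lemma J_absorbed_witness p y u v :
    ~~ (val p <= y)%O -> (p^_* <= y)%O -> (val p <= u)%O -> (u < v)%O ->
    (v <= val p `|` y)%O -> (v `&` y <= u)%O ->
  exists q, [/\ (val q <= v)%O, ~~ (val q <= u)%O, (q^_* <= u)%O &
    Delta' q + Delta' p = Delta' p].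
Proof.
move=> npy py pu uv vpy vyu.
have nle_y q : (val q <= v)%O -> ~~ (val q <= u)%O -> ~~ (val q <= y)%O.
  by move=> qv; apply: contra => qy; rewrite (le_trans _ vyu)// lexI qv.
have q_neq_p q : ~~ (val q <= u)%O -> val q != val p.
  by apply: contraNneq => ->.
have [[t [tv ntu npty]]|min_v] :=
  pselect (exists t, [/\ (t <= v)%O, ~~ (t <= u)%O & ~~ (val p <= t `|` y)%O]).
  have [q [qt nqu qu]] := J_witness ntu; have qv := le_trans qt tv.
  exists q; split=> //; apply: ll_Delta'; left; split; first exact: q_neq_p.
  exists y; split; [exact: nle_y | by [] | exact: le_trans vpy | right].
  apply: contra npty => /le_trans; apply.
  by rewrite leUx leUr (le_trans qt) ?leUl.
have {}min_v t : (t <= v)%O -> ~~ (val p <= t `|` y)%O -> (t <= u)%O.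
  by move=> tv npty; apply/negPn/negP => ntu; apply: min_v; exists t.
have [q [qv nqu qu]] := J_witness (negbT (lt_geF uv)).
have pqy : (val p <= val q `|` y)%O.
  by apply: contraT => /(min_v _ qv); rewrite (negbTE nqu).
have qpy := le_trans qv vpy.
have qyE : (val q `|` y = val p `|` y)%O.
  by apply: le_anti; rewrite !leUx qpy pqy !leUr.
exists q; split=> //; apply: ll_Delta'.
(* Equality is the first alternative of [D1], with witness [y]. Otherwise [q] is not below the join
   of [q^_*] and [y], which then serves as the witness for [Dinf]. *)
have [eq_qy | neq_qy] := eqVneq (val q `|` y)%O (q^_* `|` y)%O.
  left; split; first exact: q_neq_p.
  by exists y; split=> //; [exact: nle_y | left].
right; split; first exact: q_neq_p.
have nqy' : ~~ (val q <= q^_* `|` y)%O.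
  apply: contra neq_qy => qy'; apply/eqP/le_anti.
  by rewrite !leUx qy' !leUr (le_trans (lower_star_le _)) ?leUl.
exists (q^_* `|` y)%O; split=> //.
- rewrite !joinA (join_l (lower_star_le _)) joinAC -qyE joinAC.
  by rewrite (join_l (lower_star_le _)).
- by rewrite leUx leUl (le_trans py) ?leUr.
set w := (X in (_ `|` X)%O).
suff wu : (w <= u)%O by apply: contra nqu => /le_trans; apply; rewrite leUx pu.
apply: min_v.
  by apply: (le_trans (leIr _ _)); rewrite leUx qv (le_trans pu (ltW uv)).
apply: contra nqy' => pw; have {}pw : (val p <= q^_* `|` y)%O.
  by apply: (le_trans pw); rewrite leUx leUr leIl.
by apply: (le_trans qpy); rewrite leUx pw leUr.
Qed.

Lemma chain_dim_absorbed p y u v :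
    ~~ (val p <= y)%O -> (p^_* <= y)%O -> (val p <= u)%O -> (u <= v)%O ->
    (v <= val p `|` y)%O -> (v `&` y <= u)%O ->
  chain_dim u v + Delta' p = Delta' p.
Proof.
move=> npy py pu uv vpy; move: u uv pu; apply: (BCF_up_ind bcfL) => u.
rewrite le_eqVlt => /predU1P[-> _|uv IH] pu vyu.
  by rewrite chain_dimxx add0r.
have [q [qv nqu qu qp]] := J_absorbed_witness npy py pu uv vpy vyu.
have uqv : (u `|` val q <= v)%O by rewrite leUx (ltW uv).
rewrite (chain_dimD (leUl _ _) uqv) chain_dim_perspective// -addrA IH//.
- by rewrite lt_neqAle leUl eq_sym eq_joinl nqu.
- exact: le_trans (leUl _ _).
- exact: le_trans (leUl _ _).
Qed.

(** A first step [p] from [w] is also a step from [y], leading to [z]. What lies between the end of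
    the step from [w] and the meet of [x] and [z] is absorbed by [Delta' p]. The rest is transposed
    by induction with [z] in place of [y], so [y] must stay general. *)
Lemma chain_dim_modular x y : chain_dim (x `&` y)%O x = chain_dim y (y `|` x)%O.
Proof.
move wE : (x `&` y)%O => w; have wx : (w <= x)%O by rewrite -wE leIl.
move: w wx y wE; apply: (BCF_up_ind bcfL) => w.
rewrite le_eqVlt => /predU1P[-> _ y /eqP|wx IH y wE].
  by rewrite eq_meetl => xy; rewrite join_l// !chain_dimxx.
have [p [px npw pw]] := J_witness (negbT (lt_geF wx)).
have npy : ~~ (val p <= y)%O by apply: contra npw => py; rewrite -wE lexI px.
have py : (p^_* <= y)%O by apply: le_trans pw _; rewrite -wE leIr.
have wpx : (w `|` val p <= x)%O by rewrite leUx (ltW wx).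
set z := (y `|` val p)%O.
have wpz : (w `|` val p <= x `&` z)%O.
  rewrite lexI wpx leUx leUr andbT -wE.
  exact: le_trans (leIr _ _) (leUl _ _).
rewrite (@chain_dimD w (w `|` val p) x)// ?leUl// chain_dim_perspective//.
rewrite (@chain_dimD (w `|` val p) (x `&` z) x)// ?leIl//.
rewrite addrA [X in X + _]addrC.
rewrite (@chain_dim_absorbed p y) ?leUr//; last 2 first.
- by rewrite joinC leIr.
- by apply: le_trans (leUl _ _); rewrite -wE -meetA leI2// leIr.
rewrite (IH _ _ (leIl _ _) z)//; last first.
  by rewrite (lt_le_trans _ wpz)// lt_neqAle leUl eq_sym eq_joinl npw.
rewrite (@chain_dimD y z (y `|` x)) ?leUl//; last by rewrite leUx leUl lexUr.
by rewrite chain_dim_perspective// /z -joinA (join_r px).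
Qed.

End BCFLattice.

(** * The defining relations of [Dim L] as equations on pairs *)

Section DeltaRelations.
Variables (d : Order.disp_t) (L : latticeType d).
Implicit Types x y z : L.
Local Open Scope ring_scope.

(* [Delta] without its proof argument; [0] if [x] is not below [y]. *)
Definition total_Delta x y : Dim L :=
  oapp (pres_gen (@Dim_rel d L)) 0 (insub (x, y)).

Lemma total_DeltaE x y (xy : (x <= y)%O) : total_Delta x y = Delta xy.
Proof. by rewrite /total_Delta insubT. Qed.

Lemma total_Deltaxx x : total_Delta x x = 0.
Proof. by rewrite (total_DeltaE (lexx x)); apply/pres_rel/Dim_rel0. Qed.

Lemma total_DeltaD x y z : (x <= y)%O -> (y <= z)%O ->
  total_Delta x z = total_Delta x y + total_Delta y z.
Proof.
move=> xy yz; rewrite (total_DeltaE xy) (total_DeltaE yz).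
rewrite (total_DeltaE (le_trans xy yz)) [RHS]pres_add_cat.
exact/pres_rel/Dim_relD.
Qed.

Lemma total_Delta_modular x y :
  total_Delta (x `&` y)%O x = total_Delta y (y `|` x)%O.
Proof.
rewrite joinC (total_DeltaE (leIl x y)) (total_DeltaE (leUr y x)).
exact/pres_rel/Dim_relM.
Qed.

End DeltaRelations.

(** * The relations of [Dim' L] hold in [Dim L] *)

Section InverseMap.
Variables (d : Order.disp_t) (L : bLatticeType d).
Hypothesis bcfL : BCF L.
Implicit Types (x y z : L) (p q : J L).
Local Open Scope ring_scope.

Local Notation "p ^_*" := (lower_star (val p)) (at level 2, format "p ^_*").
Local Notation Dlt := (@total_Delta _ L).

Lemma Delta_at_perspective p x : ~~ (val p <= x)%O -> (p^_* <= x)%O ->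
  Delta_at (val p) = Dlt x (x `|` val p)%O.
Proof.
move=> npx px; rewrite -total_Delta_modular (meet_lower_star bcfL)//.
exact/esym/total_DeltaE.
Qed.

Lemma D0_Delta_at p q : D0 (val p) (val q) ->
  Delta_at (val p) = Delta_at (val q).
Proof.
case=> _ [x []]; rewrite leUx => npx /andP[px qx] pqx.
rewrite !(@Delta_at_perspective _ x)// ?(joinC x) ?pqx//.
apply: contra npx => qx'; rewrite -(join_r qx') -pqx; exact: leUl.
Qed.

Lemma D1_Delta_at p q : D1 (val p) (val q) ->
  Delta_at (val p) + Delta_at (val q) = Delta_at (val q).
Proof.
case=> _ [x [npx qx pqx]].
have nqx : ~~ (val q <= x)%O by apply: contra npx => /join_r <-.
(* Transposing the interval from [x] to its join with [p] down to [p] and to [p^_*] gives two values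
   differing by [Delta_at (val p)]. So that interval absorbs it, and it is a part of the transposed
   interval of [q]. *)
have absorbed : (val p `|` x = p^_* `|` x)%O ->
    Delta_at (val p) + Delta_at (val q) = Delta_at (val q).
  move=> pE; have pxE : (val p `&` x = p^_* `&` x)%O.
    apply/le_anti/andP; split; last by rewrite leI2 ?lower_star_le.
    rewrite lexI leIr andbT.
    by apply: (lt_lower_star bcfL); rewrite lt_neqAle leIl andbT eq_meetl.
  have pxq : (val p `|` x <= val q `|` x)%O by rewrite leUx pqx leUr.
  have eqA : Dlt x (val p `|` x)%O = Dlt (p^_* `&` x)%O p^_*.
    by rewrite pE joinC total_Delta_modular.
  have eqA' : Dlt x (val p `|` x)%O =
      Dlt (p^_* `&` x)%O p^_* + Delta_at (val p).
    rewrite joinC -total_Delta_modular pxE.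
    rewrite (@total_DeltaD _ _ _ p^_*) ?leIl ?lower_star_le//.
    by rewrite (total_DeltaE (lower_star_le _)).
  rewrite (@Delta_at_perspective q x)// (joinC x).
  rewrite (total_DeltaD (leUr _ _) pxq) addrA; congr (_ + _).
  by rewrite {1}eqA addrC -eqA'.
case=> [/absorbed// | nqpx].
(* Enlarge [x] by [p^_*]. If this does not put [p] below it, the transposed interval of [q] above it
   splits into a step [p] followed by a step [q]. *)
have [px' | npx'] := boolP (val p <= p^_* `|` x)%O.
  by apply/absorbed/le_anti; rewrite leUx px' leUr leU2 ?lower_star_le.
have qx' : (q^_* <= p^_* `|` x)%O by apply: le_trans (leUr _ _).
have x'px : (p^_* `|` x `|` val p = val p `|` x)%O.
  by rewrite joinAC (join_r (lower_star_le _)).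
have nqx' : ~~ (val q <= p^_* `|` x)%O.
  by apply: contra nqpx => /le_trans; apply; rewrite leU2 ?lower_star_le.
have pqE : (p^_* `|` x `|` val q = p^_* `|` x `|` val p `|` val q)%O.
  apply/le_anti/andP; split; first by rewrite leU2 ?leUl.
  by rewrite leUx leUr andbT leUx leUl (le_trans pqx)// joinC leU2 ?leUr.
rewrite (Delta_at_perspective npx' (leUl _ _)).
rewrite {1}(@Delta_at_perspective q (p^_* `|` x `|` val p)%O); last 2 first.
- by rewrite x'px.
- exact: le_trans (leUl _ _).
rewrite -total_DeltaD ?leUl// -pqE.
exact/esym/Delta_at_perspective.
Qed.

(** The interval from [y] to the join of [p] and [q] splits into steps [q] and [p], while
    transposing it up to [x] gives the single step [q]. *)
Lemma Dinf_Delta_at p q : Dinf (val p) (val q) ->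
  Delta_at (val p) + Delta_at (val q) = Delta_at (val q).
Proof.
case=> _ [x [npx pqx]]; rewrite leUx => /andP[px qx] npy.
have nqx : ~~ (val q <= x)%O.
  by apply: contra npx => qx'; rewrite -(join_r qx') -pqx leUl.
set y := (x `&` (val p `|` val q))%O in npy.
have py : (p^_* <= y)%O.
  by rewrite lexI px (le_trans (lower_star_le _)) ?leUl.
have qy : (q^_* <= y)%O.
  by rewrite lexI qx (le_trans (lower_star_le _)) ?leUr.
have nqy : ~~ (val q <= y)%O by rewrite lexI negb_and nqx.
rewrite joinC in npy.
have pqE : (y `|` val q `|` val p = val p `|` val q)%O.
  by rewrite -joinA (joinC (val q)) join_r// leIr.
rewrite (Delta_at_perspective npy (le_trans py (leUl _ _))).
rewrite {1}(@Delta_at_perspective q y)// addrC -total_DeltaD ?leUl//.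
rewrite pqE /y (meetC x) total_Delta_modular.
rewrite (Delta_at_perspective nqx qx) joinA (joinC x (val p)) pqx.
by rewrite joinAC joinxx joinC.
Qed.

(** Each step contributes its own interval in [Dim L], and these telescope; hence [g] undoes the map
    given by [chain_dim]. *)
Lemma chain_sum_additive (g : {additive Dim' L -> Dim L}) x y m :
  (forall p, g (Delta' p) = Delta_at (val p)) -> chain_sum y x m ->
  g m = Dlt x y.
Proof.
move=> gE; elim=> [|{}x p {}m npx px ch IH].
  by rewrite raddf0 total_Deltaxx.
rewrite raddfD /= gE IH (Delta_at_perspective npx px) -total_DeltaD ?leUl//.
exact: chain_sum_le ch.
Qed.

End InverseMap.

Theorem theorem4p4 (d : Order.disp_t) (L : bLatticeType d) (hL : BCF L) :
  exists f : {additive Dim L -> Dim' L},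
    bijective f /\ forall p : J L, f (Delta_at (val p)) = Delta' p.
Proof.
have [|f fE] := @pres_lift _ (@Dim_rel d L) (Dim' L)
  (fun i => chain_dim (val i).1 (val i).2).
  move=> s t [x|x y z xy yz|x y]; rewrite ?big_cons big_nil ?addr0 /=.
  - exact: chain_dimxx.
  - exact: chain_dimD.
  - by rewrite chain_dim_modular// joinC.
have [|g gE] := @pres_lift _ (@Dim'_rel d L) (Dim L)
  (fun p => Delta_at (val p)).
  move=> s t [p q|p q]; rewrite ?big_cons big_nil ?addr0.
    exact: D0_Delta_at.
  by case; [apply: D1_Delta_at | apply: Dinf_Delta_at].
have f_at p : f (Delta_at (val p)) = Delta' p.
  have pp : ~~ (val p <= lower_star (val p)).
    by rewrite lt_geF ?lower_star_lt.
  (* The interval of [Delta_at] is itself a single step [p], starting at [lower_star (val p)]. *)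
  rewrite fE /= -[in RHS](chain_dim_perspective hL pp (lexx _)).
  by rewrite join_r ?lower_star_le.
exists f; split=> //; exists g; apply: pres_gen_cancel.
  move=> [[x y] /= xy]; rewrite fE /=.
  rewrite (chain_sum_additive hL gE (chain_dimP hL xy)).
  exact: total_DeltaE.
by move=> p; rewrite gE f_at.
Qed.
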